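(* Let $N\ge 2$, $q\in(0,1)$, and let $P=(p_{ij})$ be an irreducible row-stochastic $N\times N$ matrix. Consider the push-sum algorithm driven by i.i.d. updates $K(t)$ with message probability matrix $P$ (see context). Then, for every initial vector $x(0)\in\mathbb R^N$, almost surely $$\limsup_{t\to\infty}\frac1t\max_i\log\left|\frac{x_i(t)}{w_i(t)}-\bar x\right|\le \frac12\log\rho\Big((I-J)\big(P_q^\top P_q+q^2(\Gamma-P^\top P)\big)(I-J)\Big),$$ where $\Gamma$ is the diagonal matrix with $\Gamma_{ii}=\sum_j p_{ji}$ and $\rho(\cdot)$ denotes the spectral radius. Furthermore, if $P$ is symmetric, then almost surely $$\limsup_{t\to\infty}\frac1t\max_i\log\left|\frac{x_i(t)}{w_i(t)}-\bar x\right|\le \frac12\log\big((1-q)^2+2q(1-q)\lambda_2+q^2\big),$$ where $\lambda_2$ is the second largest eigenvalue of $P$ (eigenvalues listed with multiplicity in decreasing order $\lambda_1=1\ge\lambda_2\ge\dots\ge\lambda_N$).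
   Context: Setup: $N\ge2$, $[N]=\{1,\dots,N\}$, $e_1,\dots,e_N$ the standard basis of $\mathbb R^N$, $\mathbf 1$ the all-ones vector, $J=\mathbf 1\mathbf 1^\top/N$. $P=(p_{ij})$ is a row-stochastic $N\times N$ matrix (the message probability matrix), $q$ a constant, and $P_q=(1-q)I+qP$. Let $\beta_1,\dots,\beta_N$ be independent random variables with values in $[N]$ and $\mathbb P(\beta_i=j)=p_{ij}$, and set $K=(1-q)I+q\sum_{i=1}^N e_ie_{\beta_i}^\top$ (each node $i$ sends a fraction $q$ of its values to the single random recipient $\beta_i$). $(K(t))_{t\ge1}$ are i.i.d. copies of $K$. Push-sum algorithm: given $x(0)\in\mathbb R^N$ and $w(0)=\mathbf 1$, set $x(t)^\top=x(t-1)^\top K(t)$, $w(t)^\top=w(t-1)^\top K(t)$ for $t\ge1$; $\bar x=\frac1N\sum_i x_i(0)$. (For $q<1$ all $w_i(t)>0$.) Irreducibility of $P$ means the directed graph with an edge $i\to j$ whenever $p_{ij}>0$ is strongly connected (in the paper $P$ is supported on the edges of a connected graph). *)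

(* Defs.v *)
From HB Require Import structures.
From mathcomp Require Import all_boot all_order all_algebra.
From mathcomp Require Import all_classical all_reals all_analysis.
From mathcomp Require Import complex.

Set Implicit Arguments.
Unset Strict Implicit.
Unset Printing Implicit Defensive.

Import Order.TTheory GRing.Theory Num.Theory.
Local Open Scope classical_set_scope.
Local Open Scope ring_scope.

Section PushSum.
Context {R : realType} {N : nat}.

Definition row_stochastic (P : 'M[R]_N) : Prop :=
  (forall i j, 0 <= P i j) /\ (forall i, \sum_j P i j = 1).

Definition irreducible_mx (P : 'M[R]_N) : Prop :=
  forall i j : 'I_N, connect [rel a b | 0 < P a b] i j.

Definition Pq (q : R) (P : 'M[R]_N) : 'M[R]_N := (1 - q)%:M + q *: P.

Definition Gamma (P : 'M[R]_N) : 'M[R]_N := diag_mx (\row_i \sum_j P j i).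

Definition Jmx : 'M[R]_N := const_mx (N%:R^-1).

Definition spectral_radius (A : 'M[R]_N) : R :=
  sup [set Normc.normc z | z in
        [set z : R[i] | eigenvalue (map_mx (fun x : R => (x%:C)%C) A) z]].

Definition Kmx (q : R) (beta : 'I_N -> 'I_N) : 'M[R]_N :=
  (1 - q)%:M + q *: \sum_i delta_mx i (beta i).

Fixpoint pushsum (q : R) (betas : nat -> 'I_N -> 'I_N) (v0 : 'rV[R]_N) (t : nat)
  : 'rV[R]_N :=
  match t with
  | 0 => v0
  | t'.+1 => pushsum q betas v0 t' *m Kmx q (betas t'.+1)
  end.

Definition xbar (x0 : 'rV[R]_N) : R := (\sum_i x0 0 i) / N%:R.

Definition elog (r : R) : \bar R := if r == 0 then -oo%E else (ln r)%:E.

Definition pushsum_err (q : R) (betas : nat -> 'I_N -> 'I_N) (x0 : 'rV[R]_N)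
  (t : nat) : R :=
  \big[Num.max/0]_i `| pushsum q betas x0 t 0 i / pushsum q betas (const_mx 1) t 0 i
                       - xbar x0 |.

Definition pushsum_rate (q : R) (betas : nat -> 'I_N -> 'I_N) (x0 : 'rV[R]_N)
  (t : nat) : \bar R :=
  ((t%:R)^-1)%:E * elog (pushsum_err q betas x0 t).

End PushSum.

(** beta : nat -> T -> ('I_N -> 'I_N) is a sequence (indexed by t >= 1) of
    random maps such that all beta_i(t) are independent with
    Pr(beta_i(t) = j) = p_ij: the joint law of (beta(1),...,beta(n)) is the
    product law, for every n. *)
Definition iid_messages {R : realType} {N : nat} {d : measure_display}
  {T : measurableType d} (Pr : probability T R) (P : 'M[R]_N)
  (beta : nat -> T -> 'I_N -> 'I_N) : Prop :=
  (forall t i j, measurable [set w | beta t w i = j]) /\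
  (forall (n : nat) (b : nat -> 'I_N -> 'I_N),
     Pr [set w | forall t, (1 <= t <= n)%N -> forall i, beta t w i = b t i]
       = (\prod_(1 <= t < n.+1) \prod_i P i (b t i))%:E).

(* Main.v *)
Require Import Defs.
From HB Require Import structures.
From mathcomp Require Import all_boot all_order all_algebra.
From mathcomp Require Import all_classical all_reals all_analysis.
From mathcomp Require Import perm complex ring lra.

Set Implicit Arguments.
Unset Strict Implicit.
Unset Printing Implicit Defensive.

Import Order.TTheory GRing.Theory Num.Theory.
Local Open Scope classical_set_scope.
Local Open Scope ring_scope.

(** Write M_t = K(1)...K(t).  The error of node j at time t is
    <x0 - xbar 1, M_t e_j> / <1, M_t e_j>, and since x0 - xbar 1 sums to zero the
    numerator is controlled by the dispersion of the column M_t e_j around its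
    mean.  Reading the product from the right, a column v is updated to K v; as the
    dispersion minimizes the squared distance to constants, one update multiplies
    its expectation by at most mu, the largest value of the quadratic form E[K^T K]
    on unit vectors of zero sum.  Markov and Borel-Cantelli give the decay
    mu^(t/2) of the numerator.

    The denominator does not decay exponentially: by irreducibility some finite
    word of updates has positive probability and an entrywise positive product,
    and it almost surely occurs within the last epsilon t steps before t.

    Finally mu is at most the spectral radius of the compression of E[K^T K] to
    zero-sum vectors by the spectral theorem, and for symmetric P it is an affine
    function of the Rayleigh quotient of P, which the second eigenvalue bounds. *)

(** * Expectation over independent message maps *)

Notation messages N := {ffun 'I_N -> 'I_N}.

Section Expectation.
Context {R : realType} {N : nat}.
Implicit Types (P : 'M[R]_N) (f : messages N) (s : seq (messages N)).

Definition msg_prob P f : R := \prod_i P i (f i).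

Definition msgs_prob P s : R := \prod_(f <- s) msg_prob P f.

(** An iterated finite sum, with the first round at the head of the list; [prob_history] turns it
    into probabilities under [Pr]. *)
Fixpoint expect P (n : nat) (F : seq (messages N) -> R) : R :=
  if n is n'.+1 then
    \sum_f msg_prob P f * expect P n' (fun s => F (f :: s))
  else F [::].

Lemma msg_prob_ge0 P f : row_stochastic P -> 0 <= msg_prob P f.
Proof. by move=> [P0 _]; exact: prodr_ge0. Qed.

(** Put [g] into the factor of node [k] and distribute the sum over the product; every other factor
    is a row sum, hence 1. *)
Lemma sum_msg_prob_marginal P (k : 'I_N) (g : 'I_N -> R) :
  row_stochastic P -> \sum_f msg_prob P f * g (f k) = \sum_j P k j * g j.
Proof.
move=> [_ P1].
pose F i j := P i j * (if i == k then g j else 1).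
transitivity (\sum_(f : messages N) \prod_i F i (f i)).
  apply: eq_bigr => f _; rewrite big_split /=; congr (_ * _).
  by rewrite -big_mkcond big_pred1_eq.
rewrite -bigA_distr_bigA (bigD1 k) //= [X in _ * X]big1 ?mulr1.
  by apply: eq_bigr => j _; rewrite /F eqxx.
move=> i /negPf ik; rewrite -(P1 i).
by apply: eq_bigr => j _; rewrite /F ik mulr1.
Qed.

Lemma sum_msg_prob P : row_stochastic P -> \sum_f msg_prob P f = 1.
Proof.
move=> [_ P1]; rewrite /msg_prob -(bigA_distr_bigA (fun i j => P i j)).
exact: big1.
Qed.

Lemma expect_le P n F G : row_stochastic P ->
  (forall s, size s = n -> F s <= G s) -> expect P n F <= expect P n G.
Proof.
move=> Ps; elim: n F G => [|n IH] F G FG /=; first exact: FG.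
apply: ler_sum => f _; apply: ler_wpM2l; first exact: msg_prob_ge0.
by apply: IH => s sn; apply: FG; rewrite /= sn.
Qed.

Lemma eq_expect P n F G :
  (forall s, size s = n -> F s = G s) -> expect P n F = expect P n G.
Proof.
elim: n F G => [|n IH] F G FG /=; first exact: FG.
apply: eq_bigr => f _; congr (_ * _).
by apply: IH => s sn; apply: FG; rewrite /= sn.
Qed.

Lemma expect_cst P n a : row_stochastic P -> expect P n (fun=> a) = a.
Proof.
move=> Ps; elim: n => [//|n IH] /=.
by rewrite IH -mulr_suml sum_msg_prob // mul1r.
Qed.

Lemma expectZ P n a F : expect P n (fun s => a * F s) = a * expect P n F.
Proof.
elim: n F => [//|n IH] F /=; rewrite mulr_sumr.
by apply: eq_bigr => f _; rewrite IH mulrCA.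
Qed.

Lemma expect_sum P n (I : finType) (F : I -> seq (messages N) -> R) :
  expect P n (fun s => \sum_i F i s) = \sum_i expect P n (F i).
Proof.
elim: n F => [//|n IH] F /=; rewrite exchange_big /=.
by apply: eq_bigr => f _; rewrite IH mulr_sumr.
Qed.

Lemma expectD P n F G :
  expect P n (fun s => F s + G s) = expect P n F + expect P n G.
Proof.
elim: n F G => [//|n IH] F G /=; rewrite -big_split.
by apply: eq_bigr => f _; rewrite IH mulrDr.
Qed.

Lemma expect_cat P m n F :
  expect P (m + n) F = expect P m (fun s1 => expect P n (fun s2 => F (s1 ++ s2))).
Proof.
elim: m F => [//|m IH] F /=.
by apply: eq_bigr => f _; rewrite IH.
Qed.

Lemma expect_indic_eq P s : expect P (size s) (fun s' => (s' == s)%:R) = msgs_prob P s.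
Proof.
rewrite /msgs_prob; elim: s => [|f s IH] /=; first by rewrite big_nil.
rewrite big_cons (bigD1 f) //= big1 ?addr0.
  congr (_ * _); rewrite -IH; apply: eq_expect => s' _.
  by rewrite eqseq_cons eqxx.
move=> g gf; rewrite (_ : expect _ _ _ = expect P (size s) (fun s => 0 * 1)).
  by rewrite expectZ mul0r mulr0.
by apply: eq_expect => s' _; rewrite eqseq_cons (negPf gf) mul0r.
Qed.

Lemma expect_indic_neq P s : row_stochastic P ->
  expect P (size s) (fun s' => (s' != s)%:R) = 1 - msgs_prob P s.
Proof.
move=> Ps; apply/eqP; rewrite eq_sym subr_eq -expect_indic_eq -expectD.
apply/eqP; rewrite -[LHS](expect_cst (size s) 1 Ps); apply: eq_expect => s' _.
by case: eqVneq; rewrite ?addr0 ?add0r.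
Qed.

Lemma expect_markov P n (A : seq (messages N) -> bool) F a :
  row_stochastic P -> 0 < a -> (forall s, size s = n -> 0 <= F s) ->
  (forall s, size s = n -> A s -> a <= F s) ->
  expect P n (fun s => (A s)%:R) <= expect P n F / a.
Proof.
move=> Ps a0 F0 AF; rewrite mulrC -expectZ; apply: expect_le => // s sn.
have [As|_] := boolP (A s); last by rewrite mulr_ge0 ?F0 // invr_ge0 ltW.
by rewrite mulrC ler_pdivlMr // mul1r; exact: AF.
Qed.

End Expectation.

(** * Products of update matrices and lower bounds on their entries *)

Section Kprod.
Context {R : realType} {N : nat}.
Implicit Types (P : 'M[R]_N) (f : messages N) (s : seq (messages N)) (q : R).

(** The earliest round is the leftmost factor, so prepending a round applies one update to every
    column. *)
Definition Kprod q s : 'M[R]_N := foldr (fun f A => Kmx q f *m A) 1%:M s.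

Lemma Kmx_mulE q (f : 'I_N -> 'I_N) m (A : 'M[R]_(N, m)) i j :
  (Kmx q f *m A) i j = (1 - q) * A i j + q * A (f i) j.
Proof.
rewrite /Kmx mulmxDl mul_scalar_mx -scalemxAl !mxE; congr (_ + _ * _).
rewrite (bigD1 (f i)) //= [X in _ + X]big1 ?addr0 => [|k kfi].
  rewrite summxE (bigD1 i) //= big1 ?addr0 ?mxE ?eqxx ?mul1r // => k ki.
  by rewrite mxE eq_sym (negPf ki).
rewrite summxE big1 ?mul0r // => k' _; rewrite mxE.
by case: (eqVneq i k') => //= <-; rewrite (negPf kfi).
Qed.

Lemma Kprod_consE q f s i j :
  Kprod q (f :: s) i j = (1 - q) * Kprod q s i j + q * Kprod q s (f i) j.
Proof. exact: Kmx_mulE. Qed.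

Lemma Kprod_cat q s1 s2 : Kprod q (s1 ++ s2) = Kprod q s1 *m Kprod q s2.
Proof. by elim: s1 => [|f s1 IH] /=; rewrite ?mul1mx // IH mulmxA. Qed.

Lemma Kprod_ge0 q s i j : 0 < q < 1 -> 0 <= Kprod q s i j.
Proof.
move=> /andP[q0 q1]; elim: s i j => [|f s IH] i j; first by rewrite mxE ler0n.
by rewrite Kprod_consE addr_ge0 // mulr_ge0 // ?subr_ge0 ltW.
Qed.

Lemma Kprod_row_sum q s i : \sum_j Kprod q s i j = 1.
Proof.
elim: s i => [|f s IH] i.
  rewrite (bigD1 i) //= mxE eqxx big1 ?addr0 // => j ji.
  by rewrite mxE eq_sym (negPf ji).
under eq_bigr do rewrite Kprod_consE.
by rewrite big_split /= -!mulr_sumr !IH; ring.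
Qed.

Lemma Kprod_le1 q s i j : 0 < q < 1 -> Kprod q s i j <= 1.
Proof.
move=> hq; rewrite -(Kprod_row_sum q s i) (bigD1 j) //= lerDl.
by apply: sumr_ge0 => k _; exact: Kprod_ge0.
Qed.

(** In each round a node keeps at least the fraction [1 - q] of its own mass. *)
Lemma Kprod_diag_ge q s i : 0 < q < 1 -> (1 - q) ^+ size s <= Kprod q s i i.
Proof.
move=> hq; have /andP[q0 q1] := hq.
elim: s i => [|f s IH] i; first by rewrite mxE eqxx.
rewrite Kprod_consE /= exprS -[leLHS]addr0 lerD //.
  by rewrite ler_wpM2l // subr_ge0 ltW.
by rewrite mulr_ge0 ?Kprod_ge0 // ltW.
Qed.

(** The rows of the left factor are probability vectors: they average the entries of a column and
    preserve any lower bound on it. *)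
Lemma Kprod_cat_ge q s1 s2 a j : 0 < q < 1 ->
  (forall k, a <= Kprod q s2 k j) -> forall i, a <= Kprod q (s1 ++ s2) i j.
Proof.
move=> hq as2 i; rewrite Kprod_cat mxE -[a]mul1r -(Kprod_row_sum q s1 i) mulr_suml.
by apply: ler_sum => k _; rewrite ler_wpM2l // Kprod_ge0.
Qed.

Lemma Kprod_cat_entry q s1 s2 i k j : 0 < q < 1 ->
  Kprod q s1 i k * Kprod q s2 k j <= Kprod q (s1 ++ s2) i j.
Proof.
move=> hq; rewrite Kprod_cat mxE (bigD1 k) //= lerDl.
by apply: sumr_ge0 => l _; rewrite mulr_ge0 // Kprod_ge0.
Qed.

Lemma msg_ofP P i j : row_stochastic P -> 0 < P i j ->
  exists2 f, 0 < msg_prob P f & f i = j.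
Proof.
move=> [P0 P1] Pij.
have /fin_all_exists[g Pg] (k : 'I_N) : exists l, 0 < P k l.
  apply: contrapT => /forallNP h; have := P1 k; rewrite big1 => [/eqP|l _].
    by rewrite eq_sym oner_eq0.
  by apply/eqP; rewrite eq_le P0 andbT leNgt; apply/negP/h.
exists [ffun k => if k == i then j else g k]; last by rewrite ffunE eqxx.
by apply: prodr_gt0 => k _; rewrite ffunE; case: eqVneq => [->|].
Qed.

(** Follow a path from [i] to [j], one round per edge. *)
Lemma positive_entry P q i j : row_stochastic P -> irreducible_mx P ->
  0 < q < 1 -> exists2 s, 0 < msgs_prob P s & 0 < Kprod q s i j.
Proof.
move=> Ps /(_ i j)/connectP[p + ->] hq; have /andP[q0 q1] := hq.
elim: p i => [|k p IH] i /=.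
  by move=> _; exists [::]; rewrite /msgs_prob ?big_nil // mxE eqxx ltr01.
move=> /andP[Pik /IH[s ps Ks]]; have [f pf fi] := msg_ofP Ps Pik.
exists (f :: s); first by rewrite /msgs_prob big_cons mulr_gt0.
by rewrite Kprod_consE fi ltr_wpDl ?mulr_gt0 // mulr_ge0 ?Kprod_ge0 // subr_ge0 ltW.
Qed.

(** Concatenate words that make the entries positive one pair of nodes at a time; positive diagonals
    keep the entries already gained. *)
Lemma positive_block P q : row_stochastic P -> irreducible_mx P ->
  0 < q < 1 -> exists2 s, 0 < msgs_prob P s &
    exists2 c, 0 < c & forall i j, c <= Kprod q s i j.
Proof.
move=> Ps Pirr hq; have /andP[q0 q1] := hq.
have diag0 s i : 0 < Kprod q s i i.
  by apply: lt_le_trans (Kprod_diag_ge _ _ hq); rewrite exprn_gt0 // subr_gt0.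
have H (l : seq ('I_N * 'I_N)) : exists2 s, 0 < msgs_prob P s &
    forall ij, ij \in l -> 0 < Kprod q s ij.1 ij.2.
  elim: l => [|[i j] l [s2 p2 IH]]; first by exists [::]; rewrite // /msgs_prob big_nil.
  have [s1 p1 K1] := positive_entry i j Ps Pirr hq.
  exists (s1 ++ s2); first by rewrite /msgs_prob big_cat mulr_gt0.
  move=> [a b]; rewrite inE => /orP[/eqP[-> ->]|/IH Kab].
    by apply: lt_le_trans (Kprod_cat_entry s1 s2 i j j hq); rewrite mulr_gt0.
  by apply: lt_le_trans (Kprod_cat_entry s1 s2 a a b hq); rewrite mulr_gt0.
have [s ps Ks] := H (enum {: 'I_N * 'I_N}); exists s => //.
(* All entries lie in [0, 1], so their product is below each of them. *)
exists (\prod_(ij : 'I_N * 'I_N) Kprod q s ij.1 ij.2).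
  by apply: prodr_gt0 => ij _; apply: Ks; rewrite mem_enum.
move=> i j; rewrite (bigD1 (i, j)) //= -[leRHS]mulr1.
rewrite ler_wpM2l ?Kprod_ge0 //; apply: prodr_ile1 => ij _.
by rewrite Kprod_ge0 //= Kprod_le1.
Qed.

Definition entries_ge (a : R) (A : 'M[R]_N) : bool := [forall i, forall j, a <= A i j].

Lemma entries_geP a (A : 'M[R]_N) : reflect (forall i j, a <= A i j) (entries_ge a A).
Proof. by apply: (iffP 'forall_forallP). Qed.

(* Cut the product into blocks of the length of the positive pattern s0: a small
   entry can only occur if none of the blocks is s0. *)
Lemma small_entry_prob P q s0 (c : R) m : row_stochastic P -> 0 < q < 1 ->
  0 < c <= 1 -> (forall i j, c <= Kprod q s0 i j) ->
  expect P (m * size s0)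
    (fun s => (~~ entries_ge (c * (1 - q) ^+ (m * size s0)) (Kprod q s))%:R)
  <= (1 - msgs_prob P s0) ^+ m.
Proof.
move=> Ps hq /andP[c0 c1] cs0; have /andP[q0 q1] := hq.
have p0 : 0 <= 1 - q by rewrite subr_ge0 ltW.
have shrink k l : (1 - q) ^+ (k + l) <= (1 - q) ^+ l.
  by apply: ler_wiXn2l; [|rewrite lerBlDr lerDl ltW|exact: leq_addl].
elim: m => [|m IH].
  by rewrite expr0 -[leRHS](expect_cst (0 * size s0) 1 Ps); apply: expect_le => // s _; case: (~~ _).
rewrite mulSn expect_cat exprS.
set a := c * (1 - q) ^+ _ in IH *.
set E := expect P (m * size s0) _ in IH.
have le1 : 0 <= 1 - msgs_prob P s0.
  rewrite -expect_indic_neq // -[leLHS](expect_cst (size s0) 0 Ps).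
  by apply: expect_le => // s _; case: (_ == _).
apply: (@le_trans _ _ ((1 - msgs_prob P s0) * E)); last exact: ler_wpM2l.
have -> : (1 - msgs_prob P s0) * E = expect P (size s0) (fun s => (s != s0)%:R * E).
  rewrite -[RHS](_ : expect P (size s0) (fun s => E * (s != s0)%:R) = _); last first.
    by apply: eq_expect => s _; rewrite mulrC.
  by rewrite expectZ mulrC expect_indic_neq.
apply: expect_le => // s1 sz1; rewrite -expectZ; apply: expect_le => // s2 sz2.
(* If the first block is [s0], it contributes [c] and the diagonal of the remaining product at least
   [(1 - q) ^+ size s2]. Otherwise a lower bound on the remaining product survives prepending
   [s1]. *)
have [->|ns] := eqVneq s1 s0; rewrite /= ?mul0r ?mul1r.
  suff -> : entries_ge (c * (1 - q) ^+ (size s0 + m * size s0)) (Kprod q (s0 ++ s2)).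
    by [].
  apply/entries_geP => i j; apply: le_trans (Kprod_cat_entry _ _ _ j _ hq).
  apply: ler_pM => //; [exact: ltW|exact: exprn_ge0|].
  apply: le_trans (Kprod_diag_ge _ _ hq).
  by rewrite sz2; exact: shrink.
have [/entries_geP g|_] := boolP (entries_ge a (Kprod q s2)).
  suff -> : entries_ge (c * (1 - q) ^+ (size s0 + m * size s0)) (Kprod q (s1 ++ s2)).
    by [].
  apply/entries_geP => i j; apply: Kprod_cat_ge => // k; apply: le_trans (g k j).
  by rewrite ler_wpM2l ?(ltW c0) //; exact: shrink.
by case: (~~ _).
Qed.

End Kprod.

(** * Contraction of the dispersion of columns *)

Section Dispersion.
Context {R : realType} {N : nat}.
Implicit Types (P : 'M[R]_N) (f : messages N) (s : seq (messages N)) (q : R).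
Implicit Types (u v : 'I_N -> R).

Definition mean v : R := (\sum_i v i) / N%:R.

Definition dispersion v : R := \sum_i (v i - mean v) ^+ 2.

(** The quadratic form of E[K^T K], that is, the mean of |K u|^2 over one round. *)
Definition edge_energy P q u : R :=
  \sum_i \sum_j P i j * ((1 - q) * u i + q * u j) ^+ 2.

(** The link between the probabilistic and the spectral arguments: both rates come from exhibiting
    such a [mu]. *)
Definition contracts P q (mu : R) : Prop :=
  forall u, \sum_i u i = 0 -> edge_energy P q u <= mu * \sum_i u i ^+ 2.

Lemma dispersion_ge0 v : 0 <= dispersion v.
Proof. by apply: sumr_ge0 => i _; exact: sqr_ge0. Qed.

Lemma sum_sub_mean v : (0 < N)%N -> \sum_i (v i - mean v) = 0.
Proof.
move=> N0; rewrite sumrB sumr_const card_ord -mulr_natr divfK ?subrr //.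
by rewrite pnatr_eq0 -lt0n.
Qed.

(** The cross term vanishes because deviations from the mean sum to zero. *)
Lemma dispersion_le v c : (0 < N)%N -> dispersion v <= \sum_i (v i - c) ^+ 2.
Proof.
move=> N0; rewrite -subr_ge0 /dispersion -sumrB.
rewrite (eq_bigr (fun i => (mean v - c) ^+ 2 + 2 * (mean v - c) * (v i - mean v))).
  rewrite big_split /= -[X in _ + X]mulr_sumr sum_sub_mean // mulr0 addr0.
  by apply: sumr_ge0 => i _; exact: sqr_ge0.
by move=> i _; ring.
Qed.

(** Lagrange's identity: twice the defect is a sum of squares. *)
Lemma cauchy_schwarz_sum u v :
  (\sum_i u i * v i) ^+ 2 <= (\sum_i u i ^+ 2) * (\sum_i v i ^+ 2).
Proof.
have E (a b : 'I_N -> R) :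
    (\sum_i a i) * (\sum_i b i) = \sum_i \sum_j a i * b j.
  by rewrite mulr_suml; apply: eq_bigr => i _; rewrite mulr_sumr.
suff : 0 <= 2 * ((\sum_i u i ^+ 2) * (\sum_i v i ^+ 2) - (\sum_i u i * v i) ^+ 2).
  by rewrite pmulr_rge0 // subr_ge0.
have -> : 2 * ((\sum_i u i ^+ 2) * (\sum_i v i ^+ 2) - (\sum_i u i * v i) ^+ 2) =
    \sum_i \sum_j (u i * v j - u j * v i) ^+ 2.
  rewrite mulr_natl mulr2n {2}[_ * \sum_i v i ^+ 2]mulrC expr2 !E -!sumrB -big_split /=.
  apply: eq_bigr => i _; rewrite -!sumrB -big_split /=.
  by apply: eq_bigr => j _; ring.
by apply: sumr_ge0 => i _; apply: sumr_ge0 => j _; exact: sqr_ge0.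
Qed.

(** Test on the difference of two basis vectors, available since [1 < N]: its energy is nonnegative
    and its norm positive. *)
Lemma contracts_ge0 P q mu : (1 < N)%N -> row_stochastic P -> contracts P q mu -> 0 <= mu.
Proof.
move=> N1 [P0 _] /(_ (fun i => (i == 0%N :> nat)%:R - (i == 1%N :> nat)%:R)).
set u := fun i : 'I_N => _ => /(_ _)/le_trans mule.
have N0 := ltnW N1; pose i0 := Ordinal N0; pose i1 := Ordinal N1.
have u0 : \sum_i u i = 0.
  have E (k : 'I_N) : \sum_(i < N) ((i : nat) == k)%:R = 1 :> R.
    rewrite (bigD1 k) //= eqxx big1 ?addr0 // => i.
    by rewrite -val_eqE /= => /negPf->.
  by rewrite sumrB (E i0) (E i1) subrr.
have : 0 <= mu * \sum_i u i ^+ 2.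
  apply: le_trans (mule _ _ (lexx _)) => //; apply: sumr_ge0 => i _.
  by apply: sumr_ge0 => j _; rewrite mulr_ge0 // sqr_ge0.
rewrite pmulr_lge0 // (bigD1 i0) //= ltr_pwDl // ?sumr_ge0 // /u /=.
  by rewrite subr0 expr1n.
by move=> i _; exact: sqr_ge0.
Qed.

(** An update fixes constants, so measuring the new dispersion around the old mean of [v] gives the
    energy of the centered vector [u]. *)
Lemma expected_dispersion_step P q mu v : (0 < N)%N -> row_stochastic P ->
  contracts P q mu ->
  \sum_(f : messages N) msg_prob P f * dispersion (fun i => (1 - q) * v i + q * v (f i))
  <= mu * dispersion v.
Proof.
move=> N0 Ps cP; pose u i := v i - mean v.
apply: le_trans (cP u (sum_sub_mean v N0)).
apply: (@le_trans _ _ (\sum_(f : messages N) \sum_i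
    msg_prob P f * ((1 - q) * u i + q * u (f i)) ^+ 2)).
  apply: ler_sum => f _; rewrite -mulr_sumr ler_wpM2l ?msg_prob_ge0 //.
  apply: le_trans (dispersion_le _ (mean v) N0) _.
  by apply: ler_sum => i _; rewrite le_eqVlt; apply/orP; left; apply/eqP; rewrite /u; ring.
rewrite exchange_big /=; apply: ler_sum => i _.
by rewrite (sum_msg_prob_marginal i (fun j => ((1 - q) * u i + q * u j) ^+ 2)).
Qed.

Lemma expect_dispersion P q mu n (j : 'I_N) : row_stochastic P -> contracts P q mu ->
  0 <= mu -> expect P n (fun s => dispersion (fun i => Kprod q s i j)) <= mu ^+ n.
Proof.
move=> Ps cP mu0; have N0 : (0 < N)%N by apply: leq_ltn_trans (ltn_ord j).
elim: n => [|n IH] /=.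
  (* The empty product is the identity, whose [j]-th column has squared distance 1 to the constant
     0. *)
  apply: le_trans (dispersion_le _ 0 N0) _.
  rewrite (bigD1 j) //= big1 => [|i ij]; rewrite mxE ?eqxx ?(negPf ij) ?subr0 ?expr1n ?addr0 //.
  by rewrite expr0n.
rewrite exprS; apply: le_trans (ler_wpM2l mu0 IH); rewrite -expectZ.
under eq_bigr do rewrite -expectZ.
rewrite -(expect_sum P n (fun (f : messages N) s =>
  msg_prob P f * dispersion (fun i => (Kmx q f *m Kprod q s) i j))).
apply: expect_le => // s _.
apply: le_trans (expected_dispersion_step (fun i => Kprod q s i j) N0 Ps cP).
apply: ler_sum => f _; rewrite le_eqVlt; apply/orP; left; apply/eqP.
by congr (_ * dispersion _); apply/funext => i; rewrite Kmx_mulE.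
Qed.

(* Rounds are numbered from 1: entry k of the history is the message map of round k+1. *)
Definition history (betas : nat -> 'I_N -> 'I_N) (t : nat) : seq (messages N) :=
  mkseq (fun k => [ffun i => betas k.+1 i]) t.

Lemma pushsum_history q betas (x : 'rV[R]_N) t :
  pushsum q betas x t = x *m Kprod q (history betas t).
Proof.
have historyS n : history betas n.+1 =
    history betas n ++ [:: [ffun i => betas n.+1 i]].
  by rewrite /history /mkseq -{1}addn1 iotaD map_cat.
elim: t => [|t IH]; first by rewrite /= /Kprod mulmx1.
rewrite historyS Kprod_cat mulmxA -IH /=; congr (_ *m _).
rewrite /Kprod /= mulmx1; congr ((1 - q)%:M + q *: _).
by apply: eq_bigr => i _; rewrite ffunE.
Qed.

(** Cauchy-Schwarz bounds the numerator by the norm of the centered [x0] times the root of the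
    column's dispersion; the denominator is a column sum, at least [a]. *)
Lemma pushsum_err_le q betas (x0 : 'rV[R]_N) t (V a e : R) : (0 < N)%N ->
  0 < a -> 0 <= e ->
  (forall j, dispersion (fun i => Kprod q (history betas t) i j) <= V) ->
  entries_ge a (Kprod q (history betas t)) ->
  (\sum_i (x0 0 i - xbar x0) ^+ 2) * V <= a ^+ 2 * e ^+ 2 ->
  pushsum_err q betas x0 t <= e.
Proof.
move=> N0 a0 e0 varV /entries_geP ge_a hV.
apply: bigmax_le => // j _; rewrite !pushsum_history.
set K := Kprod _ _ in varV ge_a *.
pose y i := x0 0 i - xbar x0; pose u i := K i j - mean (fun i => K i j).
have y0 : \sum_i y i = 0.
  rewrite sumrB sumr_const card_ord -mulr_natr divfK ?subrr //.
  by rewrite pnatr_eq0 -lt0n.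
pose w := ((const_mx 1 : 'rV[R]_N) *m K) 0 j.
have wE : w = \sum_i K i j.
  by rewrite /w mxE; apply: eq_bigr => i _; rewrite mxE mul1r.
have w_ge : a <= w.
  rewrite wE (bigD1 (Ordinal N0)) //= -[a]addr0 lerD // sumr_ge0 // => i _.
  exact: le_trans (ltW a0) (ge_a _ _).
have w0 : 0 < w by exact: lt_le_trans w_ge.
have numE : (x0 *m K) 0 j / w - xbar x0 =
    (\sum_i y i * u i) / w.
  rewrite -[X in _ - X](mulfK (lt0r_neq0 w0)) -mulrBl; congr (_ / _).
  (* As [y] sums to zero, subtracting the column mean does not change the pairing. *)
  transitivity (\sum_i y i * u i + (\sum_i y i) * mean (fun i => K i j)); last first.
    by rewrite y0 mul0r addr0.
  rewrite mulr_suml -big_split /= mxE wE mulr_sumr -sumrB; apply: eq_bigr => i _.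
  by rewrite /y /u; ring.
rewrite -/w numE normrM normfV (gtr0_norm w0) ler_pdivrMr //.
rewrite -(@ler_pXn2r _ 2) // ?nnegrE ?mulr_ge0 ?(ltW w0) //.
rewrite real_normK ?num_real // exprMn.
apply: le_trans (cauchy_schwarz_sum y u) _.
apply: (@le_trans _ _ (a ^+ 2 * e ^+ 2)).
  apply: le_trans hV; rewrite ler_wpM2l //; last exact: varV.
  by apply: sumr_ge0 => i _; exact: sqr_ge0.
rewrite mulrC ler_wpM2l ?sqr_ge0 // ler_pXn2r // nnegrE; exact: ltW.
Qed.

End Dispersion.

(** * The law of the message history *)

Lemma measure_partition_fintype (R : realType) (d : measure_display)
    (T : measurableType d) (mu : {measure set T -> \bar R}) (I : finType)
    (F : I -> set T) :
  (forall i, measurable (F i)) -> trivIset setT F ->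
  mu (\bigcup_i F i) = (\sum_i mu (F i))%E.
Proof.
move=> mF tF; rewrite measure_fin_bigcup //; last exact: finite_finset.
rewrite [RHS]fsbig_seq ?index_enum_uniq //; apply: eq_fsbigl.
by apply/seteqP; split => // i _ /=; rewrite mem_index_enum.
Qed.

Section Messages.
Context {R : realType} {N : nat} {d : measure_display} {T : measurableType d}.
Context (Pr : probability T R) (P : 'M[R]_N) (beta : nat -> T -> 'I_N -> 'I_N).
Context (hbeta : iid_messages Pr P beta).
Implicit Types (s : seq (messages N)).

Let hist w n := history (fun t => beta t w) n.

Let cylinder s := [set w | hist w (size s) = s].

Lemma hist_size w n : size (hist w n) = n.
Proof. exact: size_mkseq. Qed.

Lemma histS w n : hist w n.+1 = rcons (hist w n) [ffun i => beta n.+1 w i].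
Proof. by rewrite /hist /history mkseqS. Qed.

Lemma cylinderE s : cylinder s = [set w | forall t, (1 <= t <= size s)%N ->
  forall i, beta t w i = nth [ffun i => i] s t.-1 i].
Proof.
apply/seteqP; split => w /=.
  by move=> ws [//|t] /= ts i; rewrite -[in RHS]ws nth_mkseq // ffunE.
move=> ws; apply: (@eq_from_nth _ [ffun i => i]); rewrite hist_size // => t ts.
by rewrite nth_mkseq //; apply/ffunP => i; rewrite ffunE ws.
Qed.

Lemma measurable_cylinder s : measurable (cylinder s).
Proof.
have -> : cylinder s =
    \bigcap_(t in [set t | (t < size s)%N]) \bigcap_(i in [set: 'I_N])
       [set w | beta t.+1 w i = nth [ffun i => i] s t i].
  rewrite cylinderE; apply/seteqP; split => w /=.
    by move=> ws t ts i _; exact: ws t.+1 ts i.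
  by move=> ws [//|t] /= ts i; exact: ws.
apply: bigcap_measurableType => t _; apply: fin_bigcap_measurable => [|i _].
  exact: finite_finset.
exact: hbeta.1.
Qed.

Lemma prob_cylinder s : Pr (cylinder s) = (msgs_prob P s)%:E.
Proof.
rewrite cylinderE (hbeta.2 (size s) (fun t => nth [ffun i => i] s t.-1)); congr _%:E.
by rewrite big_add1 /= /msgs_prob (big_nth [ffun i => i]) big_mkord.
Qed.

(** The arbitrary prefix [s] lets the induction on [n] split the event by the next message map,
    which lengthens the prefix. *)
Lemma prob_history_prefix s n (A : pred (seq (messages N))) :
  let E := [set w | hist w (size s) = s /\ A (hist w (size s + n))] in
  measurable E /\
  Pr E = (msgs_prob P s * expect P n (fun s' => (A (s ++ s'))%:R))%:E.
Proof.
elim: n s => [|n IH] s /=.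
  rewrite cats0; have [As|nAs] := boolP (A s).
    have -> : [set w | hist w (size s) = s /\ A (hist w (size s + 0)%N)] = cylinder s.
      by apply/seteqP; split => w /=; rewrite addn0; [case | move=> ws; rewrite ws].
    by rewrite mulr1; split; [exact: measurable_cylinder|exact: prob_cylinder].
  have -> : [set w | hist w (size s) = s /\ A (hist w (size s + 0)%N)] = set0.
    by rewrite -subset0 => w /=; rewrite addn0 => -[->]; rewrite (negPf nAs).
  by rewrite mulr0 measure0; split.
have -> : [set w | hist w (size s) = s /\ A (hist w (size s + n.+1)%N)] =
    \bigcup_f [set w | hist w (size (rcons s f)) = rcons s f /\
                       A (hist w (size (rcons s f) + n)%N)].
  apply/seteqP; split => w /=.
    move=> [ws Aw]; exists [ffun i => beta (size s).+1 w i] => //=.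
    by rewrite size_rcons histS ws addSnnS.
  move=> [f _] /=; rewrite size_rcons histS addSnnS => -[/rcons_inj[-> _]].
  by [].
split; first by apply: fin_bigcup_measurable => [|f _]; [exact: finite_finset|exact: (IH _).1].
rewrite measure_partition_fintype => [||].
- rewrite (eq_bigr _ (fun f _ => (IH (rcons s f)).2)) sumEFin mulr_sumr; congr _%:E.
  apply: eq_bigr => f _; rewrite /msgs_prob -cats1 big_cat big_seq1 /= -mulrA.
  by congr (_ * (_ * _)); apply: eq_expect => s' _; rewrite -catA.
- by move=> f; exact: (IH _).1.
- apply/trivIsetP => f g _ _ fg; rewrite -subset0 => w /= [[wf _] [wg _]].
  move: wf; rewrite size_rcons -(size_rcons s g) wg => /rcons_inj[] gf.
  by rewrite gf eqxx in fg.
Qed.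

Lemma measurable_history n (A : pred (seq (messages N))) :
  measurable [set w | A (hist w n)].
Proof.
have [+ _] := prob_history_prefix [::] n A.
by congr measurable; apply/seteqP; split => w //= [].
Qed.

Lemma prob_history n (A : pred (seq (messages N))) :
  Pr [set w | A (hist w n)] = (expect P n (fun s => (A s)%:R))%:E.
Proof.
have [_] := prob_history_prefix [::] n A.
rewrite /msgs_prob big_nil mul1r => <-.
by congr (Pr _); apply/seteqP; split => w //= [].
Qed.

(** Geometric bounds are summable, so the limsup event is null. *)
Lemma borel_cantelli_history (A : nat -> pred (seq (messages N))) (C a : R) :
  0 <= C -> 0 < a < 1 ->
  (forall t, expect P t (fun s => (A t s)%:R) <= C * a ^+ t) ->
  {ae Pr, forall w, exists n, forall t, (n <= t)%N -> ~~ A t (hist w t)}.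
Proof.
move=> C0 /andP[a0 a1] Ale.
pose F t := [set w | A t (hist w t)].
have mF t : measurable (F t) by exact: measurable_history.
exists (lim_sup_set F); split.
- by apply: bigcap_measurableType => n _; exact: bigcup_measurable.
- apply: lim_sup_set_cvg0 => //.
  apply: (@le_lt_trans _ _ (C / (1 - a))%:E); last by rewrite ltry.
  apply: lime_le; first exact: is_cvg_nneseries.
  apply: nearW => n; rewrite big_mkord.
  rewrite (eq_bigr _ (fun (t : 'I_n) _ => prob_history t (A t))).
  rewrite sumEFin lee_fin; apply: (@le_trans _ _ (series (geometric C a) n)).
    by rewrite /series /= big_mkord; apply: ler_sum => i _.
  by apply: geometric_le_lim => //; rewrite gtr0_norm.
move=> w /= /forallNP nw n _; apply: contrapT => nF; apply: (nw n) => t nt.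
by apply/negP => At; apply: nF; exists t.
Qed.

End Messages.

(** * Almost sure rate under a contraction bound *)

Lemma bernoulli_le (R : realDomainType) (x : R) n : 0 <= x <= 1 ->
  1 - n%:R * x <= (1 - x) ^+ n.
Proof.
move=> /andP[x0 x1]; elim: n => [|n IH]; first by rewrite mul0r subr0.
rewrite exprS; have y0 : 0 <= 1 - x by rewrite subr_ge0.
apply: le_trans (ler_wpM2l y0 IH); rewrite -subr_ge0.
have -> : (1 - x) * (1 - n%:R * x) - (1 - n.+1%:R * x) = n%:R * x ^+ 2.
  by rewrite -natr1; ring.
by rewrite mulr_ge0 // exprn_ge0.
Qed.

Lemma geometric_eventually_lt (R : realType) (a z e : R) : 0 <= a -> 0 <= z < 1 -> 0 < e ->
  exists n, forall t, (n <= t)%N -> a * z ^+ t < e.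
Proof.
move=> a0 /andP[z0 z1] e0.
have zn : `|z| < 1 by rewrite ger0_norm.
have [n _ nP] := (@cvgr0_norm_lt _ _ _ _ _ _ (cvg_geometric a zn)) e e0.
exists n => t nt; apply: le_lt_trans (nP t nt); exact: ler_norm.
Qed.

(** With [x = p / (D + 1)] and [r = 1 - x], Bernoulli's inequality gives [1 - p <= r ^+ D]; the
    constant [C], the inverse of [r ^+ D], pays for rounding [t] down to a multiple of [D]. *)
Lemma floor_div_geometric (R : realType) (p : R) (D : nat) : 0 < p <= 1 -> (0 < D)%N ->
  exists2 C, 0 <= C & exists2 r, 0 < r < 1 & forall t, (1 - p) ^+ (t %/ D) <= C * r ^+ t.
Proof.
move=> /andP[p0 p1] D0.
pose x := p / D.+1%:R; have x0 : 0 < x by rewrite divr_gt0.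
have D1 : 1 < D.+1%:R :> R by rewrite ltr1n ltnS.
have x1 : x < 1 by rewrite ltr_pdivrMr ?mul1r ?(le_lt_trans p1) // ltr0n.
have r0 : 0 < 1 - x by rewrite subr_gt0.
have r1 : 1 - x < 1 by rewrite ltrBlDr ltrDl.
exists ((1 - x) ^+ D)^-1; first by rewrite invr_ge0 exprn_ge0 // ltW.
exists (1 - x) => [|t]; first by rewrite r0 r1.
rewrite mulrC ler_pdivlMr ?exprn_gt0 //.
apply: (@le_trans _ _ ((1 - x) ^+ (D * (t %/ D) + D))).
  rewrite exprD exprM ler_wpM2r ?exprn_ge0 ?(ltW r0) //.
  apply: lerXn2r; rewrite ?nnegrE ?subr_ge0 ?exprn_ge0 ?(ltW r0) //.
  apply: le_trans (bernoulli_le D _); last by rewrite !ltW.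
  rewrite lerD2l lerN2 /x mulrA ler_pdivrMr ?ltr0n // mulrC ler_wpM2l ?(ltW p0) //.
  by rewrite ler_nat.
apply: ler_wiXn2l; [exact: ltW|exact: ltW|].
rewrite mulnC {1}(divn_eq t D) leq_add2l; apply: ltnW; exact: ltn_pmod.
Qed.

Section Rate.
Context {R : realType} {N : nat}.
Implicit Types (P : 'M[R]_N) (s : seq (messages N)) (q mu : R).

(** Examine only a final stretch of rounds, short enough that losing a factor [1 - q] per round
    leaves at least [theta ^+ t], yet made of [t %/ D] blocks, so that missing the positive pattern
    in all of them is geometrically unlikely. *)
Lemma small_entries_geometric P q (theta : R) : (0 < N)%N -> row_stochastic P ->
  irreducible_mx P -> 0 < q < 1 -> 0 < theta < 1 ->
  exists2 c, 0 < c & exists2 C, 0 <= C & exists2 r, 0 < r < 1 & forall t,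
    expect P t (fun s => (~~ entries_ge (c * theta ^+ t) (Kprod q s))%:R) <= C * r ^+ t.
Proof.
move=> N0 Ps Pirr hq /andP[th0 th1]; have /andP[q0 q1] := hq.
have [s0 p0 [c c0 cs0]] := positive_block Ps Pirr hq.
have c1 : c <= 1.
  exact: le_trans (cs0 (Ordinal N0) (Ordinal N0)) (Kprod_le1 _ _ _ hq).
have p1 : msgs_prob P s0 <= 1.
  rewrite -subr_ge0 -expect_indic_neq // -[leLHS](expect_cst (size s0) 0 Ps).
  by apply: expect_le => // s _; case: (_ == _).
have [M thM] : exists M, theta ^+ M <= 1 - q.
  have [||M MP] := @geometric_eventually_lt R 1 theta (1 - q) ler01.
  - by rewrite (ltW th0).
  - by rewrite subr_gt0.
  by exists M; move: (MP M (leqnn _)); rewrite mul1r => /ltW.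
have {}thM : theta ^+ M.+1 <= 1 - q.
  by apply: le_trans thM; apply: ler_wiXn2l; [exact: ltW|exact: ltW|].
(* One factor [1 - q] is worth at least [M.+1] factors [theta], whence this block length; the outer
   successor keeps the divisor positive whatever the length of [s0]. *)
pose D := (M.+1 * size s0).+1.
have [|C C0 [r r01 Cr]] := @floor_div_geometric R (msgs_prob P s0) D _ (ltn0Sn _).
  by rewrite p0.
exists c => //; exists C => //; exists r => // t; apply: le_trans (Cr t).
have c01 : 0 < c <= 1 by rewrite c0.
pose m := (t %/ D)%N.
apply: le_trans (small_entry_prob m Ps hq c01 cs0).
have mD : (M.+1 * (m * size s0) <= t)%N.
  apply: leq_trans (leq_trunc_div t D); rewrite -/m mulnCA leq_mul2l.
  by rewrite leqnSn orbT.
have mt : (m * size s0 <= t)%N by apply: leq_trans mD; rewrite leq_pmull.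
set E := (leRHS).
(* Fix the rounds before the final stretch: prepending them preserves lower bounds on columns. *)
rewrite -(subnK mt) expect_cat -[E](expect_cst (t - m * size s0) E Ps).
apply: expect_le => // s1 _; apply: expect_le => // s2 _.
set a := (X in entries_ge X (Kprod q s2)).
have [/entries_geP g|_] := boolP (entries_ge a (Kprod q s2)); last by case: (~~ _).
suff -> : entries_ge (c * theta ^+ (t - m * size s0 + m * size s0)) (Kprod q (s1 ++ s2)) by [].
apply/entries_geP => i j; apply: Kprod_cat_ge => // k; apply: le_trans (g k j).
rewrite subnK // ler_wpM2l ?(ltW c0) //.
apply: (@le_trans _ _ (theta ^+ (M.+1 * (m * size s0)))).
  by apply: ler_wiXn2l; [exact: ltW|exact: ltW|].
rewrite exprM; apply: lerXn2r; rewrite ?nnegrE ?subr_ge0 ?exprn_ge0 ?(ltW th0) ?(ltW q1) //.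
Qed.

Definition dispersions_le (V : R) (A : 'M[R]_N) : bool :=
  [forall j, dispersion (fun i => A i j) <= V].

(** Union bound over the columns, then Markov's inequality with the bound [mu ^+ t] on the expected
    dispersion. *)
Lemma large_dispersion_geometric P q mu (nu : R) t : row_stochastic P ->
  contracts P q mu -> 0 <= mu -> 0 < nu ->
  expect P t (fun s => (~~ dispersions_le (nu ^+ t) (Kprod q s))%:R)
  <= N%:R * (mu / nu) ^+ t.
Proof.
move=> Ps cP mu0 nu0.
apply: (@le_trans _ _ (expect P t (fun s => \sum_(j < N)
    (nu ^+ t < dispersion (fun i => Kprod q s i j))%R%:R))).
  apply: expect_le => // s _; have [_|] /= := boolP (dispersions_le _ _).
    exact: sumr_ge0.
  rewrite negb_forall => /existsP[j]; rewrite -ltNge => vj.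
  by rewrite (bigD1 j) //= vj lerDl sumr_ge0.
rewrite expect_sum mulr_natl -[in leRHS](card_ord N) -sumr_const.
apply: ler_sum => j _; pose F s := dispersion (fun i => Kprod q s i j).
have mk : expect P t (fun s => (nu ^+ t < F s)%R%:R) <= expect P t F / nu ^+ t.
  apply: expect_markov; rewrite ?exprn_gt0 // => s _; [exact: dispersion_ge0|exact: ltW].
apply: le_trans mk _.
rewrite exprMn -exprVn ler_wpM2r ?exprn_ge0 ?invr_ge0 ?(ltW nu0) //.
exact: expect_dispersion.
Qed.

Lemma pushsum_rate_le q betas (x0 : 'rV[R]_N) t (m : R) : 0 < m -> (0 < t)%N ->
  pushsum_err q betas x0 t <= Num.sqrt m ^+ t ->
  (pushsum_rate q betas x0 t <= (2^-1 * ln m)%:E)%E.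
Proof.
move=> m0 t0 err; rewrite /pushsum_rate /elog.
have t0' : 0 < t%:R :> R by rewrite ltr0n.
case: eqP => [_|/eqP en0]; first by rewrite gt0_muleNy ?leNye // lte_fin invr_gt0.
have e0 : 0 < pushsum_err q betas x0 t.
  by rewrite lt_neqAle eq_sym en0 /= /pushsum_err; exact: bigmax_ge_id.
have s0 : 0 < Num.sqrt m by rewrite sqrtr_gt0.
rewrite -EFinM lee_fin mulrC ler_pdivrMr //.
have -> : 2^-1 * ln m * t%:R = ln (Num.sqrt m ^+ t).
  rewrite lnXn // -[in LHS](sqr_sqrtr (ltW m0)) lnXn // -mulr_natr -[_ *+ t]mulr_natr.
  by field.
by rewrite ler_ln ?posrE ?exprn_gt0.
Qed.

Lemma limn_esup_le_eventually (u : nat -> \bar R) (l : \bar R) n :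
  (forall t, (n <= t)%N -> (u t <= l)%E) -> (limn_esup u <= l)%E.
Proof.
move=> ul; apply: ge_ereal_inf.
exists (ereal_sup [set u t | t in [set t | (n <= t)%N]]).
  by exists [set t | (n <= t)%N] => //; exists n.
by apply: ge_ereal_sup => _ [t /= nt <-]; exact: ul.
Qed.

(** For [mu = 0] the logarithm of [m] can be made arbitrarily negative; otherwise let [m] decrease
    to [mu]. *)
Lemma le_half_elog (L : \bar R) mu : 0 <= mu ->
  (forall m, mu < m -> (L <= (2^-1 * ln m)%:E)%E) -> (L <= (2^-1)%:E * elog mu)%E.
Proof.
move=> mu0 Lm; rewrite /elog; case: eqP => [z|/eqP nz].
  rewrite gt0_muleNy ?lte_fin ?invr_gt0 // (eq_ninfty (x := L)) // => r.
  have := Lm (expR (2 * r)); rewrite z expR_gt0 expRK mulrA mulVf ?mul1r; first by apply.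
  by rewrite pnatr_eq0.
have {mu0 nz}mu0 : 0 < mu by rewrite lt_neqAle eq_sym nz.
rewrite -EFinM; apply/lee_addgt0Pr => e e0; rewrite -EFinD.
have := Lm (mu * expR (2 * e)); rewrite ltr_pMr // expR_gt1 mulr_gt0 // => /(_ isT).
by rewrite lnM ?posrE ?expR_gt0 // expRK mulrDr (mulrA 2^-1) mulVf ?mul1r //.
Qed.

Lemma pushsum_rate_contracts P q mu (d : measure_display) (T : measurableType d)
    (Pr : probability T R) (beta : nat -> T -> 'I_N -> 'I_N) (x0 : 'rV[R]_N) :
  (1 < N)%N -> row_stochastic P -> irreducible_mx P -> 0 < q < 1 ->
  contracts P q mu -> iid_messages Pr P beta ->
  {ae Pr, forall w, (limn_esup (pushsum_rate q (fun t => beta t w) x0)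
                     <= (2^-1)%:E * elog mu)%E}.
Proof.
move=> N1 Ps Pirr hq cP hbeta; have N0 := ltnW N1.
have mu0 := contracts_ge0 N1 Ps cP.
(* Countably many bounds decreasing to the target suffice, so the exceptional null sets can be
   united. *)
suff H k : {ae Pr, forall w, (limn_esup (pushsum_rate q (fun t => beta t w) x0)
    <= (2^-1 * ln (mu + k.+1%:R^-1))%:E)%E}.
  move/ae_foralln : H; apply: filterS => w Hw; apply: le_half_elog => // m mum.
  have [k km] := ltr_add_invr mum.
  apply: le_trans (Hw k) _; rewrite lee_fin ler_wpM2l ?invr_ge0 //.
  have ? : 0 < mu + k.+1%:R^-1 by rewrite ltr_wpDl ?invr_gt0.
  by rewrite ler_ln ?posrE ?ltW // (lt_trans _ km).
set m := mu + _; have mum : mu < m by rewrite ltrDl invr_gt0.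
have m0 : 0 < m by exact: le_lt_trans mum.
(* Dispersions will stay below [nu ^+ t] and entries above [c * theta ^+ t], which asks for
   [mu < nu < m * theta ^+ 2]. *)
pose nu := (mu + m) / 2.
have munu : mu < nu by rewrite /nu; lra.
have num : nu < m by rewrite /nu; lra.
have nu0 : 0 < nu by exact: le_lt_trans munu.
(* The arithmetic mean of 1 and [nu / m] strictly exceeds the geometric one, so
   [nu / m < theta ^+ 2]. *)
pose theta := (1 + nu / m) / 2.
have k0 : 0 < nu / m by rewrite divr_gt0.
have k1 : nu / m < 1 by rewrite ltr_pdivrMr ?mul1r.
have th01 : 0 < theta < 1 by rewrite /theta; lra.
have /andP[th0 th1] := th01.
have kth : nu / m < theta ^+ 2 by rewrite /theta; nra.
have [c c0 [C C0 [r r01 small]]] := small_entries_geometric N0 Ps Pirr hq th01.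
have BC1 := borel_cantelli_history hbeta C0 r01 small.
have ratio0 : 0 <= mu / nu by rewrite divr_ge0 // ltW.
have ratio1 : mu / nu < 1 by rewrite ltr_pdivrMr ?mul1r.
(* As [mu] may be 0, the ratio [mu / nu] is enlarged to a base strictly between 0 and 1. *)
have a01 : 0 < (mu / nu + 1) / 2 < 1 by lra.
have BC2 : {ae Pr, forall w, exists n, forall t, (n <= t)%N ->
    ~~ ~~ dispersions_le (nu ^+ t) (Kprod q (history (fun t => beta t w) t))}.
  apply: (borel_cantelli_history (A := fun t s => ~~ dispersions_le (nu ^+ t) (Kprod q s))
    hbeta (ler0n _ N) a01) => t.
  apply: le_trans (large_dispersion_geometric t Ps cP mu0 nu0) _.
  by rewrite ler_wpM2l //; apply: lerXn2r; rewrite ?nnegrE; lra.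
move: BC1 BC2; apply: filterS2 => w [n1 H1] [n2 H2].
pose S := \sum_i (x0 0 i - xbar x0) ^+ 2.
have S0 : 0 <= S by apply: sumr_ge0 => i _; exact: sqr_ge0.
have numth : nu < m * theta ^+ 2 by rewrite -ltr_pdivrMl // mulrC.
have mth0 : 0 < m * theta ^+ 2 by exact: lt_trans numth.
have z01 : 0 <= nu / (m * theta ^+ 2) < 1.
  by rewrite divr_ge0 ?(ltW nu0) ?(ltW mth0) //= ltr_pdivrMr // mul1r.
(* The gap between [nu] and [m * theta ^+ 2] eventually absorbs the constants [S] and [c ^+ 2]. *)
have [n3 H3] := geometric_eventually_lt S0 z01 (exprn_gt0 2 c0).
apply: (@limn_esup_le_eventually _ _ (maxn 1 (maxn n1 (maxn n2 n3)))) => t.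
rewrite !geq_max => /and4P[t0 /H1 e /H2 v /H3 b]; apply: pushsum_rate_le => //.
rewrite negbK in v; rewrite negbK in e.
apply: (pushsum_err_le N0 _ _ _ e _ (V := nu ^+ t)).
- by rewrite mulr_gt0 // exprn_gt0.
- by rewrite exprn_ge0 // sqrtr_ge0.
- by move=> j; move/forallP : v; exact.
have -> : (c * theta ^+ t) ^+ 2 * (Num.sqrt m ^+ t) ^+ 2 = c ^+ 2 * (m * theta ^+ 2) ^+ t.
  have -> : (Num.sqrt m ^+ t) ^+ 2 = m ^+ t by rewrite exprAC sqr_sqrtr // ltW.
  by rewrite [(c * _) ^+ 2]exprMn [(m * _) ^+ t]exprMn (exprAC theta) -mulrA (mulrC (m ^+ t)).
by rewrite -/S -ler_pdivrMr ?exprn_gt0 // -mulrA -expr_div_n ltW.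
Qed.

End Rate.

(** * Quadratic forms of symmetric matrices *)

Section HermitianSpectrum.
Local Open Scope sesquilinear_scope.
Context {C : numClosedFieldType} {n : nat}.
Implicit Types (A : 'M[C]_n) (x : 'rV[C]_n).

(** Coordinates in the orthonormal eigenbasis formed by the rows of [spectralmx A] when [A] is
    Hermitian. *)
Let coord A x := x *m (spectralmx A)^t*.

Lemma unitary_norm_coord A x :
  (x *m x^t*) 0 0 = \sum_i `|coord A x 0 i| ^+ 2.
Proof.
have U1 : (spectralmx A)^t* *m spectralmx A = 1%:M.
  by rewrite -invmx_unitary ?spectral_unitarymx // mulVmx // spectral_unit.
have -> : x *m x^t* = coord A x *m (coord A x)^t*.
  by rewrite /coord trmx_mul map_mxM /= trmxCK mulmxA -(mulmxA x) U1 mulmx1.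
by rewrite mxE; apply: eq_bigr => i _; rewrite !mxE normCK.
Qed.

Lemma hermitian_form_coord A x : A \is hermsymmx ->
  (x *m A *m x^t*) 0 0 = \sum_i spectral_diag A 0 i * `|coord A x 0 i| ^+ 2.
Proof.
move=> /hermitian_normalmx/orthomx_spectralP AE.
have -> : x *m A *m x^t* = coord A x *m diag_mx (spectral_diag A) *m (coord A x)^t*.
  by rewrite {1}AE /coord trmx_mul map_mxM /= trmxCK invmx_unitary ?spectral_unitarymx // !mulmxA.
rewrite mxE; apply: eq_bigr => i _.
by rewrite mul_mx_diag !mxE normCK mulrAC mulrC.
Qed.

(** The matrix [U] intertwines [A] with its diagonal form; its determinant is nonzero and cancels
    over the polynomials. *)
Lemma char_poly_spectral A : A \is hermsymmx ->
  char_poly A = \prod_i ('X - (spectral_diag A 0 i)%:P).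
Proof.
move=> /hermitian_normalmx/orthomx_spectralP AE; set U := spectralmx A in AE.
set D := diag_mx (spectral_diag A) in AE.
have UA : U *m A = D *m U.
  by rewrite {1}AE !mulmxA mulmxV ?mul1mx // spectral_unit.
have -> : \prod_i ('X - (spectral_diag A 0 i)%:P) = char_poly D.
  rewrite char_poly_trig ?diag_mx_is_trig //; apply: eq_bigr => i _.
  by rewrite mxE eqxx mulr1n.
pose V := map_mx polyC U.
have V0 : \det V != 0.
  by rewrite det_map_mx polyC_eq0 -unitfE -unitmxE spectral_unit.
apply: (mulfI V0); rewrite [RHS]mulrC /char_poly -!det_mulmx; congr (\det _).
by rewrite /char_poly_mx mulmxBr mulmxBl -!map_mxM /= UA scalar_mxC.
Qed.

Lemma eigenvalue_spectral A z : A \is hermsymmx ->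
  eigenvalue A z -> exists i, z = spectral_diag A 0 i.
Proof.
move=> hA; rewrite eigenvalue_root_char char_poly_spectral // rootE horner_prod.
move=> /prodf_eq0[i _]; rewrite -rootE root_XsubC => /eqP->; by exists i.
Qed.

Lemma spectral_eigenvalue A i : A \is hermsymmx -> eigenvalue A (spectral_diag A 0 i).
Proof.
move=> hA; rewrite eigenvalue_root_char char_poly_spectral // (bigD1 i) //=.
by rewrite rootM root_XsubC eqxx.
Qed.

End HermitianSpectrum.

(** * Real symmetric matrices, through complexification *)

Section RealSymmetric.
Local Open Scope sesquilinear_scope.
Context {R : realType} {N : nat}.
Implicit Types (A P : 'M[R]_N) (u : 'rV[R]_N).

Let toC m n (A : 'M[R]_(m, n)) := map_mx (fun x : R => (x%:C)%C) A.

Lemma conj_realC (x : R) : Num.conj (x%:C)%C = (x%:C)%C.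
Proof. by apply/CrealP; apply/complex_realP; exists x. Qed.

Lemma toC_trmxC m n (A : 'M[R]_(m, n)) : (toC A)^t* = toC A^T.
Proof. by apply/matrixP => i j; rewrite !mxE conj_realC. Qed.

Lemma toC_hermsym A : A^T = A -> toC A \is hermsymmx.
Proof.
by move=> AT; apply/is_hermitianmxP; rewrite expr0 scale1r toC_trmxC AT.
Qed.

Lemma toC_form u A : (toC u *m toC A *m (toC u)^t*) 0 0 = (((u *m A *m u^T) 0 0)%:C)%C.
Proof. by rewrite toC_trmxC /toC -!(map_mxM (real_complex R)) mxE. Qed.

Lemma toC_norm u : (toC u *m (toC u)^t*) 0 0 = (((u *m u^T) 0 0)%:C)%C.
Proof. by rewrite toC_trmxC /toC -!(map_mxM (real_complex R)) mxE. Qed.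

Lemma normc_norm (z : R[i]) : `|z| = ((Normc.normc z)%:C)%C.
Proof. by rewrite normc_def; case: z. Qed.

Lemma normc_ge0 (z : R[i]) : 0 <= Normc.normc z.
Proof. by case: z => a b; exact: sqrtr_ge0. Qed.

Lemma spectral_diag_le_radius A i : A^T = A ->
  spectral_diag (toC A) 0 i <= ((spectral_radius A)%:C)%C.
Proof.
move=> AT; have hA := toC_hermsym AT.
have dreal : spectral_diag (toC A) 0 i \is Num.real.
  by have /mxOverP := hermitian_spectral_diag_real hA; exact.
apply: le_trans (real_ler_norm dreal) _; rewrite normc_norm lecR.
apply: ub_le_sup; last by exists (spectral_diag (toC A) 0 i) => //; exact: spectral_eigenvalue.
(* The supremum dominates its members once the set is bounded; the sum of all moduli is an upper
   bound. *)
exists (\sum_j Normc.normc (spectral_diag (toC A) 0 j)) => _ [z /= + <-].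
move=> /(eigenvalue_spectral hA)[j ->]; rewrite (bigD1 j) //= lerDl.
by apply: sumr_ge0 => k _; exact: normc_ge0.
Qed.

Lemma form_le_spectral_radius A u : A^T = A ->
  (u *m A *m u^T) 0 0 <= spectral_radius A * (u *m u^T) 0 0.
Proof.
move=> AT; rewrite -lecR rmorphM /= -toC_form -toC_norm.
rewrite (hermitian_form_coord _ (toC_hermsym AT)) (unitary_norm_coord (toC A)) mulr_sumr.
apply: ler_sum => i _; rewrite ler_wpM2r ?exprn_ge0 //.
exact: spectral_diag_le_radius.
Qed.

(** Weight [2ab <= a^2 + b^2] by the entries of [P], whose rows and, by symmetry, columns sum to
    1. *)
Lemma sym_form_le_norm P u : row_stochastic P -> P^T = P ->
  (u *m P *m u^T) 0 0 <= (u *m u^T) 0 0.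
Proof.
move=> [P0 P1] PT.
have symP i j : P i j = P j i by rewrite -{1}PT mxE.
have -> : (u *m u^T) 0 0 =
    \sum_j \sum_i P i j * ((u 0 i ^+ 2 + u 0 j ^+ 2) / 2).
  transitivity (\sum_j u 0 j ^+ 2).
    by rewrite mxE; apply: eq_bigr => j _; rewrite mxE expr2.
  pose h := \sum_j \sum_i P i j * (u 0 j ^+ 2 / 2).
  have hE : h = (\sum_j u 0 j ^+ 2) / 2.
    rewrite mulr_suml; apply: eq_bigr => j _.
    by rewrite -mulr_suml (eq_bigr (P j)) ?P1 ?mul1r.
  have hE' : h = \sum_j \sum_i P i j * (u 0 i ^+ 2 / 2).
    rewrite exchange_big /=; apply: eq_bigr => i _; apply: eq_bigr => j _.
    by rewrite symP.
  transitivity (h + h); first by rewrite hE; field.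
  rewrite {2}hE' -big_split /=; apply: eq_bigr => j _; rewrite -big_split /=.
  by apply: eq_bigr => i _; field.
rewrite mxE; apply: ler_sum => j _; rewrite !mxE mulr_suml; apply: ler_sum => i _.
rewrite -subr_ge0.
have -> : P i j * ((u 0 i ^+ 2 + u 0 j ^+ 2) / 2) - u 0 i * P i j * u 0 j =
    P i j * ((u 0 i - u 0 j) ^+ 2 / 2) by field.
by rewrite mulr_ge0 // divr_ge0 // sqr_ge0.
Qed.

(** Over the complex numbers [s] and the spectral diagonal list the same roots with multiplicity, so
    a permutation matches them; [k] is the position matched with the head of [s]. *)
Lemma spectral_diag_le_second A (s : seq R) : A^T = A -> (0 < N)%N ->
  sorted (fun a b => b <= a) s -> char_poly A = \prod_(z <- s) ('X - z%:P) ->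
  exists k, forall i, i != k -> spectral_diag (toC A) 0 i <= ((s`_1)%:C)%C.
Proof.
move=> AT N0 ssort sE; have hA := toC_hermsym AT.
have size_s : size s = N.
  by apply/eqP; rewrite -eqSS -(size_prod_XsubC s id) -sE size_char_poly.
pose d := [tuple spectral_diag (toC A) 0 i | i < N].
have : perm_eq (map (real_complex R) s) d.
  apply: prod_XsubC_eq; rewrite big_map /= big_map.
  have := char_poly_spectral hA; rewrite big_enum /= => <-.
  rewrite -(map_char_poly (real_complex R)) sE rmorph_prod /=.
  by apply: eq_bigr => z _; rewrite rmorphB /= map_polyX map_polyC.
move=> /tuple_permP[p sp].
have dE i : spectral_diag (toC A) 0 (p i) = ((s`_i)%:C)%C.
  have := congr1 (fun l => l`_i) sp.
  rewrite (nth_map 0) ?size_s // => ->.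
  by rewrite -tnth_nth !tnth_mktuple.
exists (p (Ordinal N0)) => i i0; have iE := permKV p i.
set j := (p^-1)%g i in iE.
have j0 : (0 < j)%N.
  rewrite lt0n; apply: contraNneq i0 => j0; rewrite -iE; apply/eqP; congr (p _).
  exact: val_inj.
rewrite -iE dE lecR.
have tr : transitive (fun a b : R => b <= a) by move=> a b c ba ca; exact: le_trans ca ba.
apply: (sorted_leq_nth tr _ 0 ssort) => //; rewrite ?inE size_s //.
exact: leq_ltn_trans (ltn_ord j).
Qed.

(* A combination of u and the all-ones vector is orthogonal to the only eigenvector
   whose eigenvalue may exceed the second one. *)
Lemma sym_form_le_second P (s : seq R) u : row_stochastic P -> P^T = P -> (0 < N)%N ->
  sorted (fun a b => b <= a) s -> char_poly P = \prod_(z <- s) ('X - z%:P) ->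
  \sum_i u 0 i = 0 -> (u *m P *m u^T) 0 0 <= s`_1 * (u *m u^T) 0 0.
Proof.
move=> Ps PT N0 ssort sE u0; have [P0 P1] := Ps.
(* When the second root is at least 1 the bound by the norm suffices; the rest of the argument
   relies on its being below 1. *)
have [s1|s1] := leP 1 s`_1.
  apply: le_trans (sym_form_le_norm u Ps PT) _; rewrite ler_peMl // mxE.
  by apply: sumr_ge0 => i _; rewrite mxE -expr2 sqr_ge0.
have hA := toC_hermsym PT; have [k kle] := spectral_diag_le_second PT N0 ssort sE.
set A := toC P in hA kle *; pose o : 'rV[R[i]]_N := const_mx 1; pose x := toC u.
pose y (v : 'rV[R[i]]_N) := (v *m (spectralmx A)^t*) 0 k.
have form_le v : y v = 0 -> (v *m A *m v^t*) 0 0 <= ((s`_1)%:C)%C * (v *m v^t*) 0 0.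
  move=> yv; rewrite hermitian_form_coord // (unitary_norm_coord A) mulr_sumr.
  apply: ler_sum => i _; have [->|/kle ik] := eqVneq i k.
    by rewrite -/(y v) yv normr0 expr0n /= !mulr0.
  by rewrite ler_wpM2r ?exprn_ge0.
have otE : o^t* = o^T by apply/matrixP => i j; rewrite !mxE conjC1.
have Ao : A *m o^t* = o^t*.
  rewrite otE; apply/matrixP => i j; rewrite mxE.
  transitivity (((\sum_l P i l)%:C)%C); last by rewrite P1 !mxE.
  by rewrite rmorph_sum /=; apply: eq_bigr => l _; rewrite !mxE mulr1.
have oA : o *m A = o.
  have AT : A^T = A by rewrite /A /toC map_trmx PT.
  by apply: trmx_inj; rewrite trmx_mul AT -otE Ao.
have oN : (o *m o^t*) 0 0 = N%:R.
  rewrite otE mxE -[in RHS](card_ord N) -sumr_const; apply: eq_bigr => i _.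
  by rewrite !mxE mulr1.
have xo : x *m o^t* = 0.
  rewrite otE; apply/matrixP => i j; rewrite !ord1 !mxE.
  transitivity (((\sum_l u 0 l)%:C)%C); last by rewrite u0.
  by rewrite rmorph_sum /=; apply: eq_bigr => l _; rewrite !mxE mulr1.
have ox : o *m x^t* = 0.
  rewrite -[LHS]trmxCK trmx_mul map_mxM /= trmxCK xo; apply/matrixP => i j; by rewrite !mxE conjC0.
(* Cross terms vanish since [B] fixes [o] on both sides and [o] is orthogonal to [x]; this serves
   for both [A] and the identity. *)
have expand (B : 'M[R[i]]_N) (al : R[i]) : B *m o^t* = o^t* -> o *m B = o ->
    ((x + al *: o) *m B *m (x + al *: o)^t*) 0 0 =
    (x *m B *m x^t*) 0 0 + `|al| ^+ 2 * N%:R.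
  move=> Bo oB; rewrite linearD /= linearZ /= map_mxD map_mxZ mulmxDl -scalemxAl oB.
  rewrite mulmxDl !mulmxDr -scalemxAr -[x *m B *m o^t*]mulmxA Bo xo scaler0 addr0.
  rewrite -!scalemxAl ox scaler0 add0r -scalemxAr scalerA -normCK.
  by rewrite mxE [X in _ + X]mxE oN.
(* If [o] had zero [k]-th coordinate, its Rayleigh quotient 1 would be at most the second root,
   which is below 1. *)
have [yo|yo] := eqVneq (y o) 0.
  have := form_le o yo; rewrite oA oN -(rmorph_nat (real_complex R)) -rmorphM lecR /=.
  by rewrite ler_pMl ?ltr0n // leNgt s1.
pose al := - (y x / y o).
have yv : y (x + al *: o) = 0.
  by rewrite /y mulmxDl mxE -scalemxAl [X in _ + X]mxE -/(y x) -/(y o) mulNr divfK ?subrr.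
have := form_le _ yv; rewrite expand //.
have := expand 1%:M al; rewrite mulmx1 mul1mx => /(_ erefl erefl).
rewrite !mulmx1 => ->; rewrite toC_form toC_norm mulrDr => le1.
(* The contribution of [o] appears on both sides, on the right with a factor below 1, so it can be
   removed. *)
rewrite -lecR rmorphM /= -(lerD2r (`|al| ^+ 2 * N%:R)).
apply: le_trans le1 _; rewrite lerD2l ler_piMl ?mulr_ge0 ?exprn_ge0 //.
by rewrite -(rmorph1 (real_complex R)) lecR ltW.
Qed.

End RealSymmetric.

(** * Contraction factors *)

Section Contraction.
Context {R : realType} {N : nat}.
Implicit Types (P : 'M[R]_N) (q : R) (u : 'I_N -> R).

Let row_of u : 'rV[R]_N := \row_i u i.

Lemma row_norm u : (row_of u *m (row_of u)^T) 0 0 = \sum_i u i ^+ 2.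
Proof. by rewrite mxE; apply: eq_bigr => i _; rewrite !mxE expr2. Qed.

(** Expand the square: row sums of [P] give the norm, column sums give [Gamma P], and the mixed term
    gives [P] itself. *)
Lemma edge_energyE P q u : row_stochastic P ->
  edge_energy P q u = (1 - q) ^+ 2 * (row_of u *m (row_of u)^T) 0 0 +
    2 * q * (1 - q) * (row_of u *m P *m (row_of u)^T) 0 0 +
    q ^+ 2 * (row_of u *m Gamma P *m (row_of u)^T) 0 0.
Proof.
move=> [_ P1].
have -> : (row_of u *m (row_of u)^T) 0 0 = \sum_i \sum_j P i j * u i ^+ 2.
  by rewrite row_norm; apply: eq_bigr => i _; rewrite -mulr_suml P1 mul1r.
have -> : (row_of u *m P *m (row_of u)^T) 0 0 = \sum_i \sum_j P i j * (u i * u j).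
  rewrite exchange_big mxE; apply: eq_bigr => j _; rewrite !mxE mulr_suml.
  by apply: eq_bigr => i _; rewrite !mxE; ring.
have -> : (row_of u *m Gamma P *m (row_of u)^T) 0 0 = \sum_i \sum_j P i j * u j ^+ 2.
  rewrite exchange_big mxE; apply: eq_bigr => j _.
  by rewrite /Gamma mul_mx_diag !mxE -mulr_suml; ring.
rewrite !mulr_sumr -!big_split /=; apply: eq_bigr => i _.
rewrite !mulr_sumr -!big_split /=; apply: eq_bigr => j _; ring.
Qed.

(** The products of [P^T] and [P] cancel, and what remains is E[K^T K]. *)
Lemma update_gramE P q :
  (Pq q P)^T *m Pq q P + q ^+ 2 *: (Gamma P - P^T *m P) =
  ((1 - q) ^+ 2)%:M + (q * (1 - q)) *: (P + P^T) + q ^+ 2 *: Gamma P.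
Proof.
have -> : (Pq q P)^T = (1 - q)%:M + q *: P^T.
  by apply/matrixP => i j; rewrite !mxE eq_sym.
rewrite /Pq mulmxDl !mulmxDr.
rewrite !mul_scalar_mx !mul_mx_scalar -!scalemxAl -!scalemxAr.
apply/matrixP => i j; rewrite !mxE -mulr_natr; ring.
Qed.

(** The projection [1%:M - Jmx] fixes zero-sum vectors, so on them the compressed form agrees with
    that of E[K^T K]. *)
Lemma contracts_spectral_radius P q : row_stochastic P ->
  contracts P q (spectral_radius
    ((1%:M - Jmx) *m ((Pq q P)^T *m Pq q P + q ^+ 2 *: (Gamma P - P^T *m P)) *m
     (1%:M - Jmx))).
Proof.
move=> Ps u u0; rewrite update_gramE; set S := _ + _ + _.
set A := _ *m S *m _.
have JT : (1%:M - Jmx : 'M[R]_N)^T = 1%:M - Jmx.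
  by rewrite linearB /= trmx1; congr (_ - _); apply/matrixP => i j; rewrite !mxE.
have ST : S^T = S.
  apply/matrixP => i j; rewrite !mxE (addrC (P j i)).
  by case: (eqVneq i j) => [->|].
have AT : A^T = A by rewrite /A !trmx_mul JT ST mulmxA.
have uJ : row_of u *m (1%:M - Jmx) = row_of u.
  rewrite mulmxBr mulmx1 (_ : _ *m Jmx = 0) ?subr0 //.
  apply/matrixP => i j; rewrite !mxE.
  under eq_bigr do rewrite !mxE.
  by rewrite -mulr_suml u0 mul0r.
have uJ' : (1%:M - Jmx) *m (row_of u)^T = (row_of u)^T by rewrite -{1}JT -trmx_mul uJ.
rewrite -row_norm; apply: le_trans (form_le_spectral_radius (row_of u) AT).
rewrite /A !mulmxA uJ -(mulmxA (row_of u *m S)) uJ' edge_energyE // /S.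
(* A quadratic form does not see transposition, so [P + P^T] counts as twice [P]. *)
have PT : (row_of u *m P^T *m (row_of u)^T) 0 0 = (row_of u *m P *m (row_of u)^T) 0 0.
  by rewrite -[in LHS](trmxK (row_of u)) -!trmx_mul mulmxA trmxK [LHS]mxE.
rewrite !mulmxDr !mulmxDl mul_mx_scalar -!scalemxAr -!scalemxAl.
rewrite mulmxDr mulmxDl.
rewrite le_eqVlt; apply/orP; left; apply/eqP.
move: PT.
set a := row_of u *m P^T *m _; set b := row_of u *m P *m _.
set c := row_of u *m _ *m _; set e := row_of u *m _.
by clearbody a b c e => ab; rewrite !mxE ab; ring.
Qed.

(** A symmetric stochastic matrix has column sums 1, so [Gamma P] is the identity and the energy is
    affine and increasing in the Rayleigh quotient of [P]. *)
Lemma contracts_second_eigenvalue P q (s : seq R) : (0 < N)%N ->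
  0 < q < 1 -> row_stochastic P -> P^T = P -> sorted (fun a b => b <= a) s ->
  char_poly P = \prod_(z <- s) ('X - z%:P) ->
  contracts P q ((1 - q) ^+ 2 + 2 * q * (1 - q) * s`_1 + q ^+ 2).
Proof.
move=> N0 /andP[q0 q1] Ps PT ssort sE u u0.
have G1 : Gamma P = 1%:M.
  rewrite /Gamma -[RHS]diag_const_mx; congr diag_mx; apply/rowP => i; rewrite !mxE.
  by rewrite -(Ps.2 i); apply: eq_bigr => j _; rewrite -{1}PT mxE.
have : (row_of u *m P *m (row_of u)^T) 0 0 <= s`_1 * (row_of u *m (row_of u)^T) 0 0.
  by apply: sym_form_le_second => //; under eq_bigr do rewrite mxE.
rewrite edge_energyE // G1 mulmx1 -row_norm.
set f := (row_of u *m P *m _) 0 0; set e := (row_of u *m _) 0 0 => fe.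
rewrite -subr_ge0.
have -> : ((1 - q) ^+ 2 + 2 * q * (1 - q) * s`_1 + q ^+ 2) * e -
    ((1 - q) ^+ 2 * e + 2 * q * (1 - q) * f + q ^+ 2 * e) =
    2 * q * (1 - q) * (s`_1 * e - f) by ring.
by rewrite !mulr_ge0 ?subr_ge0 ?(ltW q0) ?(ltW q1).
Qed.

End Contraction.

Theorem theorem1 (R : realType) (N : nat) (hN : (2 <= N)%N) (q : R)
  (hq : 0 < q < 1) (P : 'M[R]_N) (hPs : row_stochastic P)
  (hPirr : irreducible_mx P)
  (d : measure_display) (T : measurableType d) (Pr : probability T R)
  (beta : nat -> T -> 'I_N -> 'I_N) (hbeta : iid_messages Pr P beta)
  (x0 : 'rV[R]_N) :
  {ae Pr, forall w,
     (limn_esup (pushsum_rate q (fun t => beta t w) x0)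
      <= (2^-1)%:E *
         elog (spectral_radius
                 ((1%:M - Jmx) *m
                  ((Pq q P)^T *m Pq q P + q ^+ 2 *: (Gamma P - P^T *m P)) *m
                  (1%:M - Jmx))))%E}
  /\
  (P^T = P ->
   forall s : seq R,
     sorted (fun a b => b <= a) s ->
     char_poly P = \prod_(z <- s) ('X - z%:P) ->
     {ae Pr, forall w,
        (limn_esup (pushsum_rate q (fun t => beta t w) x0)
         <= (2^-1)%:E *
            elog ((1 - q) ^+ 2 + 2 * q * (1 - q) * s`_1 + q ^+ 2))%E}).
Proof.
split=> [|PT s ssort sE].
  exact: pushsum_rate_contracts hN hPs hPirr hq (contracts_spectral_radius q hPs) hbeta.
exact: pushsum_rate_contracts hN hPs hPirr hq
  (contracts_second_eigenvalue (ltnW hN) hq hPs PT ssort sE) hbeta.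
Qed.
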